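(* Let $D:\mathcal K\times\mathcal K\to\mathbb R$ be a divergence on $\mathcal K$. Then $D$ is a functional Bregman divergence on $\mathcal K$ if and only if for any $a\in\mathcal K$ the function $\Phi:\mathcal K\to\mathbb R$, $\Phi(p)=D(p,a)$, is convex and has a subgradient $\Phi^*:\mathcal K\to\mathcal L(\mathcal P)$ on $\mathcal K$ such that $$D(p,q)=D_{(\Phi,\Phi^* )}(p,q)\quad\text{for all }p,q\in\mathcal K.$$ Likewise, $D$ is a functional Bregman divergence on $\mathcal K$ associated with a pair whose convex function is strictly convex if and only if for any $a\in\mathcal K$ the function $\Phi(p)=D(p,a)$ is strictly convex and has a subgradient $\Phi^*:\mathcal K\to\mathcal L(\mathcal P)$ on $\mathcal K$ such that $D(p,q)=D_{(\Phi,\Phi^* )}(p,q)$ for all $p,q\in\mathcal K$.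
   Context: Let $(\Omega,\mathcal A,\mu)$ be a measure space and $\mathcal P$ a (nonempty) convex class of probability densities with respect to $\mu$ (representing probability distributions on $\Omega$ absolutely continuous with respect to $\mu$). $\mathcal L(\mathcal P)$ is the linear space of $\mathcal P$-integrable functions, i.e. functions $f:\Omega\to\mathbb R$ with $\int_\Omega |f|\,p\,d\mu<\infty$ for every $p\in\mathcal P$. For $p\in\operatorname{span}\mathcal P$ (linear span) and $f\in\mathcal L(\mathcal P)$ write $p\cdot f=\int_\Omega f(x)p(x)\,d\mu(x)$. $\mathcal K$ is a convex set with $\mathcal P\subset\mathcal K\subset\operatorname{span}\mathcal P$. A divergence on $\mathcal K$ is a nonnegative function $D:\mathcal K\times\mathcal K\to\mathbb R$ with $D(p,p)=0$ for all $p\in\mathcal K$. A subgradient of $\Phi:\mathcal K\to\mathbb R$ on $\mathcal K$ is a map $\Phi^*:\mathcal K\to\mathcal L(\mathcal P)$ such that $\Phi(p)\ge(p-q)\cdot\Phi^*(q)+\Phi(q)$ for all $p,q\in\mathcal K$. (A function that has a subgradient on $\mathcal K$ is convex.) If $\Phi:\mathcal K\to\mathbb R$ has a subgradient $\Phi^*$ on $\mathcal K$, the functional Bregman divergence on $\mathcal K$ associated with the pair $(\Phi,\Phi^* )$ is $$D_{(\Phi,\Phi^* )}(p,q)=\Phi(p)-(p-q)\cdot\Phi^*(q)-\Phi(q),\qquad p,q\in\mathcal K.$$ $D$ is called a functional Bregman divergence on $\mathcal K$ if $D=D_{(\Phi_1,\Phi_1^* )}$ for some such pair $(\Phi_1,\Phi_1^*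 )$. *)

(* Defs.v *)
From mathcomp Require Import all_boot all_order all_algebra.
From mathcomp Require Import interval_inference.
From mathcomp Require Import all_classical all_reals all_analysis.

Set Implicit Arguments.
Unset Strict Implicit.
Unset Printing Implicit Defensive.

Import Order.TTheory GRing.Theory Num.Theory.
Import numFieldNormedType.Exports.

Local Open Scope classical_set_scope.
Local Open Scope ring_scope.
Local Open Scope convex_scope.

(* Densities are functions [T -> R], representing their classes modulo
   [mu]-a.e. equality; they are not quotiented.  A divergence, a convex function
   or a subgradient on [K] is a total function of which only the values on [K]
   matter. *)

Definition linear_span (R : realType) (V : lmodType R) (P : set V) : set V :=
  [set v | exists (n : nat) (c : 'I_n -> R) (u : 'I_n -> V),
    (forall i, P (u i)) /\ v = \sum_(i < n) c i *: u i].

Section FunctionalBregman.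
Context d (T : measurableType d) (R : realType).
Variable mu : {measure set T -> \bar R}.
Implicit Types (P K : set (T -> R)) (p q f : T -> R) (Phi : (T -> R) -> R)
  (Phis : (T -> R) -> (T -> R)) (D : (T -> R) -> (T -> R) -> R).

Definition prob_density p : Prop :=
  [/\ measurable_fun setT p, forall x, 0 <= p x &
      (\int[mu]_x (p x)%:E = 1)%E].

Definition class_integrable P : set (T -> R) :=
  [set f : T -> R | measurable_fun setT f /\
    forall p, P p -> (\int[mu]_x (`|f x| * p x)%:E < +oo)%E].

(* Finite for [p] in the span of [P] and [f] in [class_integrable P]; only used
   there. *)
Definition pairing p f : R := \int[mu]_x (f x * p x).

Definition divergence K D : Prop :=
  (forall p q, K p -> K q -> 0 <= D p q) /\ (forall p, K p -> D p p = 0).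

Definition subgradient P K Phi Phis : Prop :=
  (forall q, K q -> class_integrable P (Phis q)) /\
  (forall p q, K p -> K q -> Phi p >= pairing (p - q) (Phis q) + Phi q).

Definition bregman Phi Phis p q : R :=
  Phi p - pairing (p - q) (Phis q) - Phi q.

(* The counterpart of [convex_function]; since elements of [K] represent classes
   modulo a.e. equality, "distinct" means "not a.e. equal".  A function with a
   subgradient takes equal values at a.e. equal points, so strictness could not
   hold between those. *)
Definition strictly_convex_function K Phi : Prop :=
  forall t : {i01 R}, 0 < t%:num -> t%:num < 1 ->
  forall p q : convex_lmodType (T -> R), K p -> K q -> ~ (p = q %[ae mu]) ->
    Phi (p <| t |> q) < (Phi p : R^o) <| t |> (Phi q : R^o).

Definition bregman_divergence P K D : Prop :=
  exists Phi Phis, subgradient P K Phi Phis /\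
    forall p q, K p -> K q -> D p q = bregman Phi Phis p q.

Definition strict_bregman_divergence P K D : Prop :=
  exists Phi Phis, [/\ subgradient P K Phi Phis,
    strictly_convex_function K Phi &
    forall p q, K p -> K q -> D p q = bregman Phi Phis p q].

End FunctionalBregman.

(* Main.v *)
(* Rebasing a Bregman pair at a: Phi'(p) = D(p, a) differs from Phi on K by the
   affine function p |-> (p - a) . Phi^*(a) + Phi(a), so Phi^* - Phi^*(a) is a
   subgradient of Phi' and both the divergence and (strict) convexity are
   unchanged.  Conversely, K contains some a, and the pair at that a is a witness. *)
Require Import Defs.
From mathcomp Require Import all_boot all_order all_algebra.
From mathcomp Require Import interval_inference.
From mathcomp Require Import all_classical all_reals all_analysis.
From mathcomp Require Import unstable measurable_realfun ring lra.
Import Order.TTheory GRing.Theory Num.Theory.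
Import numFieldNormedType.Exports.
Local Open Scope classical_set_scope.
Local Open Scope ring_scope.

Section Pairing.
Local Set Implicit Arguments.
Local Unset Strict Implicit.
Context (d : measure_display) (T : measurableType d) (R : realType).
Context (mu : {measure set T -> \bar R}).
Implicit Types (P : set (T -> R)) (p q f g : T -> R).

(** The side condition for every linearity rule of [pairing]: a real-valued integral is additive
    only on integrable functions. *)
Local Notation paired p f := (mu.-integrable setT (EFin \o (f \* p)%R)).

Lemma paired_density P p f : (forall q, P q -> prob_density mu q) -> P p ->
  class_integrable mu P f -> paired p f.
Proof.
move=> dP Pp [mf fP]; have [mp p0 _] := dP _ Pp.
apply/integrableP; split.
  by apply/measurable_EFinP; exact: measurable_funM.
under eq_integral do rewrite /= normrM (ger0_norm (p0 _)).
exact: fP.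
Qed.

(** Multiplying [f] by a finite combination of densities gives the same combination of the products
    [f * u i], each integrable by [paired_density]. *)
Lemma paired_span P p f : (forall q, P q -> prob_density mu q) ->
  linear_span P p -> class_integrable mu P f -> paired p f.
Proof.
move=> dP [n [c [u [Pu ->]]]] fP.
have -> : EFin \o (f \* (\sum_(i < n) c i *: u i)) =
    (fun x => \sum_(i < n) ((c i)%:E * (EFin \o (f \* u i)%R) x))%E.
  apply/funext => x /=; rewrite sumEFin fct_sumE mulr_sumr; congr EFin.
  by apply: eq_bigr => i _; rewrite /= mulrCA.
apply: integrable_sum => // i _; apply: integrableZl => //.
exact: (paired_density dP (Pu i)).
Qed.

Lemma pairedB p q f : paired p f -> paired q f -> paired (p - q) f.
Proof.
move=> pf qf; have -> : EFin \o (f \* (p - q)) =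
    ((EFin \o (f \* p)%R) \- (EFin \o (f \* q)%R))%E.
  by apply/funext => x /=; rewrite -EFinB -mulrBr.
exact: integrableB.
Qed.

Lemma pairingBl p q f : paired p f -> paired q f ->
  pairing mu (p - q) f = pairing mu p f - pairing mu q f.
Proof.
move=> pf qf; rewrite /pairing -RintegralB//.
by apply: eq_Rintegral => x _; rewrite /= mulrBr.
Qed.

Lemma pairingBr p f g : paired p f -> paired p g ->
  pairing mu p (f - g) = pairing mu p f - pairing mu p g.
Proof.
move=> pf pg; rewrite /pairing -RintegralB//.
by apply: eq_Rintegral => x _; rewrite /= mulrBl.
Qed.

Lemma pairing_conv p q f (t : {i01 R}) : paired p f -> paired q f ->
  pairing mu (conv t (p : convex_lmodType (T -> R)) q) f =
  t%:num * pairing mu p f + (1 - t%:num) * pairing mu q f.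
Proof.
move=> pf qf; rewrite /pairing -!RintegralZl// -RintegralD//.
(* At each point [conv t p q] computes to [t * p x + (1 - t) * q x], so only the scalars have to be
   moved past [f x]. *)
- by apply: eq_Rintegral => x _; rewrite [X in X + _]mulrCA [X in _ + X]mulrCA -mulrDr.
- exact: (integrableZl measurableT t%:num pf).
- exact: (integrableZl measurableT (1 - t%:num) qf).
Qed.

(** A density is nonnegative, so [|f| * p] is the norm of [f * p]; the bound therefore follows from
    integrability of the products, which is stable under differences. *)
Lemma class_integrableB P f g : (forall q, P q -> prob_density mu q) ->
  class_integrable mu P f -> class_integrable mu P g ->
  class_integrable mu P (f - g).
Proof.
move=> dP fP gP; split; first by apply: measurable_funB; [case: fP|case: gP].
move=> p Pp; have [mp p0 _] := dP _ Pp.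
have : paired p (f - g).
  have -> : EFin \o ((f - g) \* p) =
      ((EFin \o (f \* p)%R) \- (EFin \o (g \* p)%R))%E.
    by apply/funext => x /=; rewrite -EFinB -mulrBl.
  by apply: integrableB => //; exact: (paired_density dP Pp).
move=> /integrableP[_]; under eq_integral do rewrite /= normrM (ger0_norm (p0 _)).
by [].
Qed.

End Pairing.

Section Bregman.
Local Set Implicit Arguments.
Local Unset Strict Implicit.
Context (d : measure_display) (T : measurableType d) (R : realType).
Context (mu : {measure set T -> \bar R}) (P K : set (T -> R)).
Hypothesis P_density : forall p, P p -> prob_density mu p.
Hypothesis K_convex : convex_set K.
Hypothesis K_span : K `<=` linear_span P.
Implicit Types (p q a f : T -> R) (Phi : (T -> R) -> R)
  (Phis : (T -> R) -> T -> R) (D : (T -> R) -> (T -> R) -> R).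

Let pairedK p f : K p -> class_integrable mu P f ->
  mu.-integrable setT (EFin \o (f \* p)%R).
Proof. by move=> /K_span; exact: paired_span. Qed.

(** The supporting affine function at [z = conv t p q] lies below [Phi] at both [p] and [q].
    Averaging the two inequalities with weights [t] and [1 - t] cancels the linear terms, since
    [t (p - z) + (1 - t) (q - z) = 0]. *)
Lemma subgradient_convex Phi Phis :
  subgradient mu P K Phi Phis -> convex_function K Phi.
Proof.
move=> [iPhis sPhi] t p q; rewrite !inE => Kp Kq.
have Kz : K (conv t p q).
  by have := @K_convex p q t; rewrite !inE; apply.
set z := conv t p q; have iz := iPhis _ Kz.
have zf := pairedK Kz iz; have pf := pairedK Kp iz; have qf := pairedK Kq iz.
have := sPhi _ _ Kp Kz; have := sPhi _ _ Kq Kz; rewrite !pairingBl//.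
rewrite [pairing mu (conv t p q) _]pairing_conv// -/z.
rewrite convRE /onem.
have t0 : 0 <= t%:num by [].
have t1 : 0 <= 1 - t%:num by rewrite subr_ge0.
move=> /(ler_wpM2l t1) Hq /(ler_wpM2l t0) Hp.
(* The sum of the two weighted inequalities is the goal up to a polynomial identity, so linear
   arithmetic over monomials suffices. *)
move: Hp Hq; rewrite -/z; lra.
Qed.

Section Rebase.
Variables (Phi : (T -> R) -> R) (Phis : (T -> R) -> T -> R).
Variables (D : (T -> R) -> (T -> R) -> R) (a : T -> R).
Hypothesis Phi_subgradient : subgradient mu P K Phi Phis.
Hypothesis D_bregman : forall p q, K p -> K q -> D p q = bregman mu Phi Phis p q.
Hypothesis Ka : K a.

Lemma bregman_rebase p q : K p -> K q ->
  bregman mu (fun p => D p a) (fun q => Phis q - Phis a) p q = D p q.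
Proof.
move=> Kp Kq; have [iPhis _] := Phi_subgradient.
have iq := iPhis _ Kq; have ia := iPhis _ Ka.
(* The two copies of [Phi a] cancel, and [(p - a) - (q - a) - (p - q) = 0] removes every pairing
   with [Phis a]. *)
rewrite /bregman !D_bregman// /bregman pairingBr; try
  by apply: pairedB; exact: pairedK.
by rewrite !pairingBl; try exact: pairedK; ring.
Qed.

(** The subgradient inequality of a pair says exactly that its Bregman expression is nonnegative;
    here that expression is [D], by [bregman_rebase]. *)
Lemma subgradient_rebase : (forall p q, K p -> K q -> 0 <= D p q) ->
  subgradient mu P K (fun p => D p a) (fun q => Phis q - Phis a).
Proof.
move=> D0; have [iPhis _] := Phi_subgradient; split=> [q Kq|p q Kp Kq].
  by apply: class_integrableB => //; exact: iPhis.
have := D0 _ _ Kp Kq; rewrite -(bregman_rebase Kp Kq) /bregman; lra.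
Qed.

Lemma strictly_convex_rebase : strictly_convex_function mu K Phi ->
  strictly_convex_function mu K (fun p => D p a).
Proof.
move=> sPhi t t0 t1 p q Kp Kq pq.
have Kz : K (conv t p q).
  by have := @K_convex p q t; rewrite !inE; apply.
have [iPhis _] := Phi_subgradient; have ia := iPhis _ Ka.
have := sPhi t t0 t1 p q Kp Kq pq.
rewrite !convRE /onem !D_bregman// /bregman.
rewrite !pairingBl; try exact: pairedK.
(* The part subtracted from [Phi] is affine along the segment, so the strict gap at [conv t p q] is
   the one of [Phi]. *)
rewrite pairing_conv; try exact: pairedK.
lra.
Qed.

End Rebase.

End Bregman.

Theorem theorem4p1 (d : measure_display) (T : measurableType d) (R : realType)
    (mu : {measure set T -> \bar R}) (P K : set (T -> R))
    (P_nonempty : P !=set0)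
    (P_density : forall p, P p -> prob_density mu p)
    (P_convex : convex_set P)
    (K_convex : convex_set K)
    (PK : P `<=` K)
    (K_span : K `<=` linear_span P)
    (D : (T -> R) -> (T -> R) -> R)
    (D_div : divergence K D) :
  (bregman_divergence mu P K D <->
    forall a, K a ->
      convex_function K (fun p => D p a) /\
      exists Phis : (T -> R) -> (T -> R),
        subgradient mu P K (fun p => D p a) Phis /\
        forall p q, K p -> K q ->
          D p q = bregman mu (fun p' => D p' a) Phis p q)
  /\
  (strict_bregman_divergence mu P K D <->
    forall a, K a ->
      strictly_convex_function mu K (fun p => D p a) /\
      exists Phis : (T -> R) -> (T -> R),
        subgradient mu P K (fun p => D p a) Phis /\
        forall p q, K p -> K q ->
          D p q = bregman mu (fun p' => D p' a) Phis p q).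
Proof.
have [D_ge0 _] := D_div; have [a Pa] := P_nonempty; have Ka := PK _ Pa.
split; split.
- move=> [Phi [Phis [sPhi DPhi]]] b Kb.
  have sb := subgradient_rebase P_density K_span sPhi DPhi Kb D_ge0.
  (* Convexity is read off from the new subgradient, without going back to [Phi]. *)
  split; first exact: (subgradient_convex P_density K_convex K_span sb).
  exists (fun q => Phis q - Phis b); split=> // p q Kp Kq.
  by rewrite (bregman_rebase P_density K_span sPhi DPhi).
- by move=> /(_ a Ka)[_ [Phis [sPhi DPhi]]]; exists (D^~ a), Phis.
- move=> [Phi [Phis [sPhi cPhi DPhi]]] b Kb; split.
    (* A subgradient alone yields only convexity, so strictness has to be carried over from
       [Phi]. *)
    exact: (strictly_convex_rebase P_density K_convex K_span sPhi DPhi).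
  exists (fun q => Phis q - Phis b); split.
    exact: (subgradient_rebase P_density K_span sPhi DPhi Kb D_ge0).
  by move=> p q Kp Kq; rewrite (bregman_rebase P_density K_span sPhi DPhi).
- by move=> /(_ a Ka)[cD [Phis [sPhi DPhi]]]; exists (D^~ a), Phis.
Qed.
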